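(* For all $n\geq 1$, \[ \lambda_1(n)\leq\lambda_{CS}(n)\leq\lambda_2(n)+n. \]
   Context: Let $[n]=\{1,\dots,n\}$. An $n$-component (Boolean) network is a function $f:\{0,1\}^n\to\{0,1\}^n$, $f(x)=(f_1(x),\dots,f_n(x))$. For $i\in[n]$ and $x\in\{0,1\}^n$, let $f^i(x):=(x_1,\dots,x_{i-1},f_i(x),x_{i+1},\dots,x_n)$. For a word $w=i_1i_2\dots i_k$ over $[n]$, let $f^w:=f^{i_k}\circ\dots\circ f^{i_1}$ (the identity if $w$ is empty). A word $w$ fixes $f$ if $f^w(x)$ is a fixed point of $f$ for every $x\in\{0,1\}^n$. A word fixes a family of networks if it fixes every member of the family. Directed graphs have no parallel arcs and may have loops. Given a directed graph $G$ with vertex set $[n]$, the conjunctive network on $G$ is the $n$-component network $f$ defined by $f_i(x)=\bigwedge_{j\in N^-(i)}x_j$ for all $i\in[n]$ and $x\in\{0,1\}^n$, where $N^-(i)$ is the set of in-neighbors of $i$ in $G$ (with $f_i(x)=1$ if $i$ has no in-neighbor; a loop on $i$ means $i\in N^-(i)$). A directed graph is symmetric if, for all distinct vertices $i,j$, an arc from $i$ to $j$ implies an arc from $j$ to $i$ (loops are allowed on any vertices). $F_{CS}(n)$ is the family of conjunctive networks on symmetric directed graphs with vertex set $[n]$, and $\lambda_{CS}(n)$ is the minimum length of a word fixing $F_{CS}(n)$. A word $u=u_1\dots u_q$ is a subword of $w=w_1\dots w_p$ if there exist $1\leq i_1<\dots<i_q\leq p$ with $u=w_{i_1}\dots w_{i_q}$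 (not necessarily consecutive positions). For an integer $k\geq 0$, a word over the alphabet $[n]$ is $(n,k)$-universal if it contains, as subwords, all the words over $[n]$ of length $n-k$ without repeated letters. $\lambda_k(n)$ is the minimum length of an $(n,k)$-universal word, with $\lambda_k(n)=0$ for $k\geq n$. *)

(* Defs.v *)
From mathcomp Require Import all_boot.

Set Implicit Arguments.
Unset Strict Implicit.
Unset Printing Implicit Defensive.

(* The set [n] = {1, ..., n} is rendered as 'I_n, and a word
   over [n] as a sequence of type seq 'I_n. *)

Lemma min_length_exists n (P : pred (seq 'I_n)) :
  (exists w, P w) -> exists m, [exists w : m.-tuple 'I_n, P w].
Proof.
by case=> w Pw; exists (size w); apply/existsP; exists (in_tuple w).
Qed.

Definition min_length n (P : pred (seq 'I_n)) (exP : exists w, P w) : nat :=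
  ex_minn (min_length_exists exP).

Lemma min_lengthP n (P : pred (seq 'I_n)) (exP : exists w, P w) :
  (exists2 w, P w & size w = min_length exP) /\
  (forall w, P w -> min_length exP <= size w).
Proof.
rewrite /min_length; case: ex_minnP => m /existsP[w Pw] minm; split.
  by exists w; rewrite ?size_tuple.
by move=> v Pv; apply: minm; apply/existsP; exists (in_tuple v).
Qed.

Definition universal n (k : nat) (w : seq 'I_n) : bool :=
  [forall u : (n - k).-tuple 'I_n, uniq u ==> subseq u w].

Lemma universal_exists n k : exists w, @universal n k w.
Proof.
exists (flatten [seq val u | u <- enum {: (n - k).-tuple 'I_n}]).
apply/forallP=> u; apply/implyP=> _.
have : u \in enum {: (n - k).-tuple 'I_n} by rewrite mem_enum.
elim: (enum _) => //= v s IHs; rewrite inE => /predU1P[<-|/IHs us].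
  exact: prefix_subseq.
exact: subseq_trans us (suffix_subseq _ _).
Qed.

Definition lambda (k n : nat) : nat := min_length (universal_exists n k).

(* The truncated n - k makes the convention for k >= n automatic. *)
Lemma lambda_geq k n : n <= k -> lambda k n = 0.
Proof.
move=> le_nk; apply/eqP; rewrite -leqn0.
have [_ /(_ [::])] := min_lengthP (universal_exists n k); apply.
apply/forallP=> u; apply/implyP=> _.
suff /size0nil-> : size u = 0 by [].
by rewrite size_tuple; apply/eqP; rewrite subn_eq0.
Qed.

Notation state n := {ffun 'I_n -> bool}.
Notation network n := {ffun {ffun 'I_n -> bool} -> {ffun 'I_n -> bool}}.

(* The function f^i of the asynchronous dynamics. *)
Definition update n (f : network n) (i : 'I_n) (x : state n) : state n :=
  [ffun j => if j == i then f x i else x j].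

(* f^w, the first letter of w being applied first. *)
Definition updates n (f : network n) (w : seq 'I_n) (x : state n) : state n :=
  foldl (fun y i => update f i y) x w.

Definition fixes n (w : seq 'I_n) (f : network n) : bool :=
  [forall x, f (updates f w x) == updates f w x].

Definition fixes_family n (F : {set network n}) (w : seq 'I_n) : bool :=
  [forall f in F, fixes w f].

(* A directed graph on 'I_n, possibly with loops and without parallel arcs,
   is its set of arcs; (j, i) is the arc from j to i. *)
Notation digraph n := {set 'I_n * 'I_n}.

Definition conjunctive n (G : digraph n) : network n :=
  [ffun x : state n => [ffun i => [forall (j | (j, i) \in G), x j]]].

Definition symmetric_digraph n (G : digraph n) : bool :=
  [forall i, forall j, (i != j) && ((i, j) \in G) ==> ((j, i) \in G)].

Definition FCS n : {set network n} :=
  [set conjunctive G | G : digraph n & symmetric_digraph G].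

Lemma updates_cat n (f : network n) v w x :
  updates f (v ++ w) x = updates f w (updates f v x).
Proof. exact: foldl_cat. Qed.

Lemma updates_fix n (f : network n) w x : f x = x -> updates f w x = x.
Proof.
move=> fx; elim: w => //= i w; rewrite /updates /=.
suff -> : update f i x = x by [].
by apply/ffunP=> j; rewrite ffunE fx; case: eqP => // ->.
Qed.

Lemma monotone_reach_up n (f : network n)
    (fM : forall x y : state n, (forall i, x i -> y i) ->
          forall i, f x i -> f y i) (x : state n) :
  (forall i, x i -> f x i) -> exists w, f (updates f w x) = updates f w x.
Proof.
have [m] := ubnP #|[set i | ~~ x i]|; elim: m x => // m IHm x ltm le_xf.
have [fx|neq_fx] := eqVneq (f x) x; first by exists [::].
have /forallPn[i neq_i] : ~~ [forall i, f x i == x i].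
  by apply: contraNN neq_fx => /forallP eq_fx; apply/eqP/ffunP=> i; apply/eqP.
have xi : x i = false.
  by apply/negP=> xi; case/negP: neq_i; rewrite xi (le_xf i xi).
have fxi : f x i by move: neq_i; rewrite xi; case: (f x i).
have le_xy j : x j -> update f i x j by rewrite ffunE; case: eqP => // ->.
have [|j|w fw] := IHm (update f i x); last by exists (i :: w).
- rewrite ltnS in ltm; apply: leq_trans ltm; apply/proper_card/properP.
  split; first by apply/subsetP=> j; rewrite !inE; apply/contra/le_xy.
  by exists i; rewrite !inE ?xi // ffunE eqxx fxi.
- by rewrite {1}ffunE; case: eqP => [->|_ /le_xf]; apply: (fM _ _ le_xy).
Qed.

Lemma monotone_reach n (f : network n)
    (fM : forall x y : state n, (forall i, x i -> y i) ->
          forall i, f x i -> f y i) (x : state n) :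
  exists w, f (updates f w x) = updates f w x.
Proof.
have [m] := ubnP #|[set i | x i]|; elim: m x => // m IHm x ltm.
have [/forallP le_xf|] := boolP [forall i, x i ==> f x i].
  by apply: monotone_reach_up => // i; apply/implyP.
case/forallPn=> i; rewrite negb_imply => /andP[xi /negbTE fxi].
have [|w fw] := IHm (update f i x); last by exists (i :: w).
rewrite ltnS in ltm; apply: leq_trans ltm; apply/proper_card/properP; split.
  by apply/subsetP=> j; rewrite !inE ffunE; case: eqP => // _; rewrite fxi.
by exists i; rewrite !inE // ffunE eqxx fxi.
Qed.

Lemma conjunctive_monotone n (G : digraph n) (x y : state n) :
  (forall i, x i -> y i) ->
  forall i, conjunctive G x i -> conjunctive G y i.
Proof.
move=> le_xy i; rewrite !ffunE => /forall_inP xG.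
by apply/forall_inP=> j /xG/le_xy.
Qed.

Lemma fixes_FCS_exists n : exists w, fixes_family (FCS n) w.
Proof.
pose fixed w (p : network n * state n) :=
  p.1 (updates p.1 w p.2) = updates p.1 w p.2.
have [w fw] : exists w, forall p, p \in enum {: network n * state n} ->
    p.1 \in FCS n -> fixed w p.
  elim: (enum _) => [|[f x] s [w fw]]; first by exists [::].
  have [f_cs|f_cs] := boolP (f \in FCS n); last first.
    by exists w => p; rewrite inE => /predU1P[->|/fw //]; rewrite (negPf f_cs).
  have [v fv] : exists v, fixed v (f, updates f w x).
    case/imsetP: f_cs => G _ ->.
    exact/monotone_reach/conjunctive_monotone.
  exists (w ++ v) => p; rewrite inE /fixed updates_cat.
  case/predU1P=> [->|ps pF] //; have fp := fw p ps pF.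
  by rewrite (updates_fix v fp) fp.
exists w; apply/forall_inP=> f fF; apply/forallP=> x; apply/eqP.
by apply: (fw (f, x)); rewrite ?mem_enum.
Qed.

Definition lambda_CS (n : nat) : nat := min_length (fixes_FCS_exists n).

(* Main.v *)
Require Import Defs.
From mathcomp Require Import all_boot.

(* Lower bound: on a reflexive path v0 - v1 - ... - v(n-1), a single 0 placed
   at v0 must travel through v1, ..., v(n-1) in this order, so these n - 1
   letters form a subword of every fixing word.
   Upper bound: update every vertex once, then apply an (n,2)-universal word.
   Two adjacent zeros (or a zero carrying a loop) are never reset to 1. After
   the first round every zero has a zero in-neighbor, and a zero whose component
   has at least two vertices even has a zero neighbor distinct from itself. From
   such a pair of zeros any other vertex of the component is reached along a
   path with at most n - 2 new vertices, which is a subword of the universal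
   word. *)

(** * Preliminaries on universal words and on updates *)

Lemma subseq_universal {n k} {w p : seq 'I_n} :
  universal k w -> uniq p -> size p <= n - k -> subseq p w.
Proof.
move=> /forallP univ_w uniq_p le_p.
pose compl := [seq i <- enum 'I_n | i \notin p].
pose q := take (n - k - size p) compl.
have uniq_compl : uniq compl by apply/filter_uniq/enum_uniq.
have size_compl : size compl = n - size p.
  apply/eqP; rewrite -(eqn_add2l (size p)) subnKC; last first.
    by rewrite -(card_uniqP uniq_p) -[X in _ <= X]card_ord max_card.
  rewrite -[X in _ == X]card_ord -(cardC (mem p)) (card_uniqP uniq_p).
  rewrite eqn_add2l -(card_uniqP uniq_compl).
  by apply/eqP/eq_card=> i; rewrite mem_filter mem_enum [RHS]inE /= andbT.
have size_pq : size (p ++ q) == n - k.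
  rewrite size_cat size_takel ?subnKC // size_compl.
  by rewrite leq_sub2r // leq_subr.
have uniq_pq : uniq (p ++ q).
  rewrite cat_uniq uniq_p take_uniq // andbT.
  by apply/hasPn=> i /mem_take; rewrite mem_filter => /andP[].
have := univ_w (Tuple size_pq); rewrite /= uniq_pq.
exact: subseq_trans (prefix_subseq p q).
Qed.

Lemma conjunctiveN {n} {G : digraph n} {x : state n} {i} :
  reflect (exists2 j, (j, i) \in G & ~~ x j) (~~ conjunctive G x i).
Proof.
rewrite !ffunE negb_forall_in.
by apply: (iffP exists_inP) => -[j]; exists j.
Qed.

Lemma updates_rcons n (f : network n) w i x :
  updates f (rcons w i) x = update f i (updates f w x).
Proof. exact: foldl_rcons. Qed.

Lemma updates_cons n (f : network n) w i x :
  updates f (i :: w) x = updates f w (update f i x).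
Proof. by []. Qed.

Lemma updates_notin {n} (f : network n) w i x :
  i \notin w -> updates f w x i = x i.
Proof.
elim: w x => // j w IHw x; rewrite inE negb_or => /andP[/negPf neq_ij iw].
by rewrite updates_cons IHw // ffunE neq_ij.
Qed.

(** * Lower bound: a zero moving along a path with loops *)

Definition reflexive_path n (s : seq 'I_n) : digraph n :=
  [set e | index e.1 s <= (index e.2 s).+1 & index e.2 s <= (index e.1 s).+1].

Lemma reflexive_path_in_FCS n (s : seq 'I_n) :
  conjunctive (reflexive_path n s) \in FCS n.
Proof.
apply: imset_f; rewrite inE; apply/forallP=> i; apply/forallP=> j.
by rewrite !inE /=; apply/implyP=> /andP[_]; rewrite andbC.
Qed.

(* The prefix take k u records how far the 0 initially at v has travelled. *)
Lemma reflexive_path_front {n} {v : 'I_n} {u} w :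
  (forall j, j \in v :: u) ->
  exists2 k, subseq (take k u) w &
    forall j,
      ~~ updates (conjunctive (reflexive_path n (v :: u))) w
           [ffun i => i != v] j ->
      index j (v :: u) <= k.
Proof.
set s := v :: u => s_full; set f := conjunctive _; set x := finfun _.
elim/last_ind: w => [|w i [k sub_k front_k]].
  exists 0; rewrite ?take0 ?sub0seq // => j.
  by rewrite ffunE negbK => /eqP->; rewrite /= eqxx.
have zero_i : ~~ update f i (updates f w x) i -> index i s <= k.+1.
  rewrite ffunE eqxx => /conjunctiveN[l]; rewrite inE /= => /andP[_ le_il].
  by move=> /front_k le_lk; apply: leq_trans le_il _.
(* The front advances by at most one position per update; position [k.+1] in [s] is position [k] in
   [u], because of the leading [v]. *)
have [index_i|not_next] := eqVneq (index i s) k.+1.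
  have lt_ku : k < size u by rewrite -ltnS -index_i -[X in _ < X]/(size s) index_mem.
  have nth_i : nth v u k = i.
    by rewrite -[LHS]/(nth v s k.+1) -index_i nth_index.
  exists k.+1 => [|j].
    by rewrite (take_nth v) // nth_i -!cats1 cat_subseq.
  rewrite updates_rcons ffunE; case: eqP => [->|_ /front_k/leqW //].
  by rewrite index_i.
exists k => [|j]; first exact: subseq_trans sub_k (subseq_rcons w i).
rewrite updates_rcons; have [->|neq_ji] := eqVneq j i.
  by move/zero_i; rewrite leq_eqVlt (negPf not_next).
by rewrite ffunE (negPf neq_ji) => /front_k.
Qed.

Lemma fixing_universal {n} (w : seq 'I_n) :
  0 < n -> fixes_family (FCS n) w -> universal 1 w.
Proof.
move=> n_gt0 /forall_inP fix_w; apply/forallP=> u; apply/implyP=> uniq_u.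
have size_u : size u = n.-1 by rewrite size_tuple subn1.
have [v v_u] : exists v, v \notin u.
  apply/existsP; rewrite -negb_forall; apply/negP=> /forallP u_full.
  have := uniq_leq_size (enum_uniq 'I_n) (fun i _ => u_full i).
  by rewrite size_u -cardE card_ord -ltnS prednK // ltnn.
pose s := v :: u.
have uniq_s : uniq s by rewrite /= v_u.
have size_s : size s = n by rewrite /= size_u prednK.
have s_full j : j \in s.
  have [] := uniq_min_size uniq_s (fun i _ => mem_enum 'I_n i).
    by rewrite size_s -cardE card_ord.
  by move=> _ /(_ j); rewrite mem_enum.
have [k sub_k front_k] := reflexive_path_front w s_full.
move/forallP/(_ [ffun i => i != v])/eqP: (fix_w _ (reflexive_path_in_FCS n s)).
move: front_k; set f := conjunctive _; set y := updates _ _ _ => front_k fix_y.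
(* The loop keeps [v] at 0, and since [y] is a fixed point each zero forces one at the next
   vertex. *)
have zero m : m < n -> ~~ y (nth v s m).
  elim: m => [_|m IHm lt_mn] /=.
    rewrite /y; elim/last_ind: (w) => [|w' i IHw]; first by rewrite ffunE eqxx.
    rewrite updates_rcons ffunE; case: eqP => // <-.
    by apply/conjunctiveN; exists v; rewrite // inE /= eqxx.
  rewrite -fix_y; apply/conjunctiveN; exists (nth v s m); last exact/IHm/ltnW.
  rewrite inE -[nth v u m]/(nth v s m.+1) !index_uniq ?size_s //; last exact: ltnW.
  by rewrite /= leqnn andbT !leqW.
have /zero/front_k : n.-1 < n by rewrite prednK.
rewrite index_uniq ?size_s ?prednK // -size_u => le_uk.
by move: sub_k; rewrite take_oversize.
Qed.

(** * Upper bound: zeros in symmetric conjunctive networks *)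

Section Symmetric.

Variables (n : nat) (G : digraph n).
Hypothesis G_sym : symmetric_digraph G.
Local Notation f := (conjunctive G).

Lemma arc_sym i j : (i, j) \in G -> (j, i) \in G.
Proof.
have [->//|neq_ij] := eqVneq i j => ij.
by have /forallP/(_ i)/forallP/(_ j) := G_sym; rewrite neq_ij ij.
Qed.

(** By symmetry each end is an in-neighbor of the other, so updating one reads the zero of the
    other. The case [i = j] covers loops. *)
Lemma arc_zeros_persist w (x : state n) i j :
  (i, j) \in G -> ~~ x i -> ~~ x j ->
  ~~ updates f w x i && ~~ updates f w x j.
Proof.
move=> ij xi xj; elim/last_ind: w => [|w l /andP[yi yj]]; first by rewrite xi.
rewrite updates_rcons; apply/andP; split; rewrite ffunE; case: eqP => // <-.
  by apply/conjunctiveN; exists j => //; apply: arc_sym.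
by apply/conjunctiveN; exists i.
Qed.

Lemma zero_persists w (x : state n) i :
  ~~ x i -> ~~ f x i -> ~~ updates f w x i && ~~ f (updates f w x) i.
Proof.
move=> xi /conjunctiveN[j ji xj].
have /andP[yj yi] := arc_zeros_persist w x j i ji xj xi.
by rewrite yi; apply/conjunctiveN; exists j.
Qed.

(** The last update of [i] read a zero in-neighbor, which supports [i] from then on. *)
Lemma zero_after_update w (x : state n) i : i \in w ->
  ~~ updates f w x i -> ~~ f (updates f w x) i.
Proof.
elim/last_ind: w => // w j IHw; rewrite mem_rcons inE updates_rcons.
set y := updates f w x in IHw *.
have [-> _|neq_ij /IHw {}IHw] := eqVneq i j; last first.
  rewrite {1}ffunE (negPf neq_ij) => yi.
  by have /andP[] := zero_persists [:: j] y i yi (IHw yi).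
rewrite {1}ffunE eqxx => /conjunctiveN[l lj yl].
apply/conjunctiveN; exists l => //; rewrite ffunE; case: eqP => // _.
by apply/conjunctiveN; exists l.
Qed.

Lemma zero_origin w (x : state n) i : ~~ updates f w x i ->
  exists2 a, ~~ x a & connect [rel j l | (j, l) \in G] a i.
Proof.
elim/last_ind: w i => [|w j IHw] i; first by exists i.
rewrite updates_rcons ffunE; case: eqP => [-> {i}|_ /IHw //].
case/conjunctiveN=> l lj /IHw[a xa al]; exists a => //.
exact/(connect_trans al)/connect1.
Qed.

(** A supported zero at [a] persists until the next vertex of [p] is updated; that vertex then
    becomes a zero supported by [a], and takes over its role. *)
Lemma zero_travels w (x : state n) a p :
  path [rel j l | (j, l) \in G] a p -> subseq p w -> ~~ x a -> ~~ f x a ->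
  ~~ updates f w x (last a p).
Proof.
elim: w x a p => [|i w IHw] x a p.
  by rewrite subseq0 => _ /eqP->.
case: p => [_ _ xa fxa|b p ap sub_p xa fxa].
  by case/andP: (zero_persists (i :: w) x a xa fxa).
rewrite updates_cons /=; have [xa' fxa'] := andP (zero_persists [:: i] x a xa fxa).
move: ap sub_p => /= /andP[ab bp]; case: eqP => [eq_bi|_] sub_p.
  apply: IHw => //.
    by rewrite ffunE eq_bi eqxx; apply/conjunctiveN; exists a; rewrite -?eq_bi.
  by apply/conjunctiveN; exists a.
by apply: (IHw _ a (b :: p)) => //=; rewrite ab.
Qed.

Lemma looped_zero_spreads w (x : state n) a b :
  (a, a) \in G -> (a, b) \in G -> b \in w -> ~~ x a -> ~~ updates f w x b.
Proof.
move=> aa ab /splitPr[p q] xa; rewrite updates_cat updates_cons.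
set y := updates f p x.
have /andP[_ ya] : ~~ y a && ~~ y a by apply: arc_zeros_persist.
have yb : ~~ update f b y b.
  by rewrite ffunE eqxx; apply/conjunctiveN; exists a.
suff ya' : ~~ update f b y a.
  by have /andP[] := arc_zeros_persist q _ a b ab ya' yb.
by rewrite ffunE; case: eqP => // _; apply/conjunctiveN; exists a.
Qed.

(** The vertex [c] is the zero in-neighbor read at the only update of [a]. The value 1 at [b] serves
    to exclude [c = a]. *)
Lemma zero_pair w (x : state n) a b : uniq w -> (forall i, i \in w) ->
  (a, b) \in G -> ~~ updates f w x a -> updates f w x b ->
  exists2 c, c != a & (c, a) \in G /\ ~~ updates f w x c.
Proof.
move=> uniq_w w_full ab za zb.
have [p [q def_w]] : exists p q, w = p ++ a :: q.
  by have /splitPr[p q] := w_full a; exists p, q.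
move: uniq_w; rewrite def_w cat_uniq /= negb_or.
case/and4P=> _ /andP[a_p _] a_q _; rewrite -def_w.
have def_z : updates f w x = updates f q (update f a (updates f p x)).
  by rewrite def_w updates_cat.
move: (za); rewrite def_z updates_notin // ffunE eqxx.
case/conjunctiveN=> c ca yc; have [eq_ca|neq_ca] := eqVneq c a.
  (* Here [a] has a loop and is 0 from the start, so the update of [b] would have made [b] a lasting
     zero. *)
  move: ca yc; rewrite eq_ca updates_notin // => aa xa.
  by have := looped_zero_spreads w x a b aa ab (w_full b) xa; rewrite zb.
exists c => //; split=> //.
set y := update f a _; have yc' : ~~ y c by rewrite ffunE (negPf neq_ca).
have ya : ~~ y a by rewrite ffunE eqxx; apply/conjunctiveN; exists c.
by have /andP[] := arc_zeros_persist q y c a ca yc' ya.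
Qed.

Lemma universal_fixes v w : uniq v -> (forall i, i \in v) -> universal 2 w ->
  fixes (v ++ w) f.
Proof.
move=> uniq_v v_full univ_w; apply/forallP=> x; apply/eqP/ffunP=> i.
rewrite updates_cat; set z := updates f v x; set y := updates f w z.
have fz a : ~~ z a -> ~~ f z a by apply: zero_after_update.
have reached a p : ~~ z a -> path [rel j l | (j, l) \in G] a p -> uniq p ->
    size p <= n - 2 -> ~~ y (last a p).
  move=> za ap uniq_p le_p; apply: zero_travels => //; last exact: fz.
  exact: subseq_universal le_p.
(* Zeros of [y] are supported because [v] updates every vertex; it remains to show that a vertex
   with a zero in-neighbor is itself 0. *)
apply/idP/idP; apply: contraTT.
  rewrite /y /z -updates_cat => yi; apply: zero_after_update => //.
  by rewrite mem_cat v_full.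
case/conjunctiveN=> j ji /zero_origin[a za aj].
have /connectP[p0 a_p0 ->] := connect_trans aj (connect1 ji).
have [p ap uniq_ap _] := shortenP a_p0.
have le_size (s : seq 'I_n) : uniq s -> size s <= n.
  by move/card_uniqP=> <-; rewrite -[X in _ <= X]card_ord max_card.
case: p ap uniq_ap => [_ _|b p].
  by have /andP[] := zero_persists w z a za (fz a za).
move=> abp uniq_abp; have [ab bp] := andP abp.
have uniq_bp : uniq (b :: p) by case/andP: uniq_abp.
have le_p : size p <= n - 2.
  by have := leq_sub2r 2 (le_size _ uniq_abp); rewrite /= !subSS subn0.
(* The path [b :: p] from [a] may have [n - 1] letters, one too many. If [b] is already 0, the
   journey starts at [b]; otherwise [a] has another zero neighbor [c]. *)
have [zb|zb] := boolP (z b); last first.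
  by case/andP: uniq_bp => _ uniq_p; apply: (reached b).
have [c neq_ca [ca zc]] := zero_pair v x a b uniq_v v_full ab za zb.
have [c_bp|c_bp] := boolP (c \in b :: p); last first.
  apply: reached abp uniq_bp _ => //.
  (* With [c] off the path, [a] and [c] both lie outside [b :: p], which leaves at most [n - 2]
     letters. *)
  have uniq_c : uniq (c :: a :: b :: p).
    by rewrite cons_uniq inE negb_or neq_ca c_bp.
  by have := leq_sub2r 2 (le_size _ uniq_c); rewrite /= !subSS subn0.
(* With [c] on the path, the journey starts at [c], and the remainder [p2] is no longer than [p]. *)
move def_s: (b :: p) c_bp abp uniq_bp => s c_s.
case/splitPr: c_s def_s => p1 p2 /(congr1 size).
rewrite cat_path cat_uniq last_cat size_cat /= addnS => -[size_p].
case/and3P=> _ _ cp2 /and4P[_ _ _ uniq_p2]; apply: reached => //.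
by apply: leq_trans le_p; rewrite size_p leq_addl.
Qed.

End Symmetric.

Theorem theorem4 (n : nat) (hn : 1 <= n) :
  lambda 1 n <= lambda_CS n <= lambda 2 n + n.
Proof.
rewrite /lambda /lambda_CS.
have [_ min1] := min_lengthP (universal_exists n 1).
have [[w2 univ_w2 <-] _] := min_lengthP (universal_exists n 2).
have [[w fix_w <-] minCS] := min_lengthP (fixes_FCS_exists n).
apply/andP; split; first exact/min1/fixing_universal.
have -> : size w2 + n = size (enum 'I_n ++ w2).
  by rewrite size_cat -cardE card_ord addnC.
apply: minCS; apply/forall_inP=> _ /imsetP[G G_sym ->].
apply: universal_fixes univ_w2; rewrite ?enum_uniq //.
  by move: G_sym; rewrite inE.
by move=> i; rewrite mem_enum.
Qed.
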